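(* On a nearly paraKähler manifold $(M,g,P)$ the Nijenhuis tensor $N$ is parallel with respect to the canonical connection $\nabla$: $\nabla N=-\nabla T=0$, where $T$ is the torsion of $\nabla$.
   Context: An almost paraHermitian manifold $(M,g,P)$ is a smooth $2n$-manifold with a $(1,1)$-tensor $P$, $P^2=\mathrm{id}$, whose $\pm1$-eigenbundles both have rank $n$, and a pseudo-Riemannian metric $g$ (of neutral signature) with $g(PX,Y)+g(X,PY)=0$. Let $\nabla^g$ be the Levi-Civita connection. $(M,g,P)$ is nearly paraKähler if it is not paraKähler (i.e. $\nabla^gP\neq0$) and $(\nabla^g_XP)X=0$ for all $X$. The Nijenhuis tensor is given by $4N(X,Y)=[PX,PY]+[X,Y]-P[PX,Y]-P[X,PY]$. The canonical connection is $\nabla_XY=\nabla^g_XY-\frac12(\nabla^g_XP)(PY)$; it satisfies $\nabla g=\nabla P=0$ and has torsion $T=-N$. *)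

(* Defs.v *)
From HB Require Import structures.
From mathcomp Require Import all_boot all_order all_algebra.
From mathcomp Require Import all_classical all_reals all_analysis.
From mathcomp Require Import ring.

Set Implicit Arguments.
Unset Strict Implicit.
Unset Printing Implicit Defensive.

Import Order.TTheory GRing.Theory Num.Theory.
Import numFieldNormedType.Exports.

Local Open Scope classical_set_scope.
Local Open Scope ring_scope.

Section smooth_on.
Variables (R : realType) (m : nat).
Implicit Types (U : set 'rV[R]_m) (f g : 'rV[R]_m -> R) (k : nat).

(* Class C^k on an open set U; only the values of f on U matter.  The k.+1
   clause asks for a total derivative, which costs nothing: a function with
   continuous partial derivatives is differentiable. *)
Fixpoint Ck_on k U f : Prop :=
  match k with
  | 0 => forall x, U x -> {for x, continuous f}
  | k'.+1 => (forall x, U x -> differentiable f x) /\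
             (forall i : 'I_m, Ck_on k' U ('D_(delta_mx 0 i) f))
  end.

Definition smooth_on U f : Prop := forall k, Ck_on k U f.

Lemma near_eq_differentiable (f g : 'rV[R]_m -> R) x :
  {near x, f =1 g} -> differentiable f x -> differentiable g x.
Proof.
move=> fg dfx; have [dc df] := (diff_locallyP _ _).1 dfx.
have dg : g \o shift x = cst (g x) + 'd f x +o_ 0 id.
  apply/eqaddoP => e e0; have /eqaddoP/(_ e e0) := df; apply: filter_app.
  have : \forall h \near 0, f (h + x) = g (h + x).
    move: fg; rewrite (near_shift 0) /= subr0 => fg0.
    by apply: filterS fg0 => h.
  apply: filterS => h /= fgh.
  by rewrite !fctE /= fgh (nbhs_singleton fg).
by apply/diff_locallyP; rewrite (diff_unique dc dg).
Qed.

Lemma Ck_on_ext k U f g : open U -> (forall x, U x -> f x = g x) ->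
  Ck_on k U f -> Ck_on k U g.
Proof.
move=> oU; elim: k f g => [|k IH] f g fg /=.
  move=> cf x Ux; have fgx : {near x, f =1 g}.
    by apply: filterS (open_nbhs_nbhs (conj oU Ux)).
  have := cf _ Ux; rewrite /prop_for /continuous_at (fg x Ux); apply: cvg_trans.
  exact: near_eq_cvg fgx.
move=> [df Df]; split=> [x Ux|i].
  have fgx : {near x, f =1 g}.
    by apply: filterS (open_nbhs_nbhs (conj oU Ux)).
  by apply: near_eq_differentiable (df _ Ux).
apply: IH (Df i) => x Ux; apply: near_eq_derive.
by apply: filterS (open_nbhs_nbhs (conj oU Ux)).
Qed.

Lemma Ck_onW k U f : Ck_on k.+1 U f -> Ck_on k U f.
Proof.
elim: k f => [|k IH] f [df Df] /=.
  by move=> x Ux; exact/differentiable_continuous/df.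
by split=> // i; exact/IH/Df.
Qed.

Lemma Ck_on_cst k U (a : R) : open U -> Ck_on k U (fun=> a).
Proof.
move=> oU; elim: k a => [|k IH] a /=; first by move=> x _; exact: cst_continuous.
split=> [x _|i]; first exact: differentiable_cst.
by apply: Ck_on_ext (IH 0) => // x _; rewrite derive_cst.
Qed.

Lemma Ck_onD k U f g : open U ->
  Ck_on k U f -> Ck_on k U g -> Ck_on k U (f + g).
Proof.
move=> oU; elim: k f g => [|k IH] f g /=.
  by move=> cf cg x Ux; apply: continuousD; [exact: cf|exact: cg].
move=> [df Df] [dg Dg]; split=> [x Ux|i].
  by apply: differentiableD; [exact: df|exact: dg].
apply: (@Ck_on_ext k U ('D_(delta_mx 0 i) f + 'D_(delta_mx 0 i) g)) => //.
  by move=> x Ux; rewrite deriveD//; apply: diff_derivable; [exact: df|exact: dg].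
exact: IH.
Qed.

Lemma Ck_onM k U f g : open U ->
  Ck_on k U f -> Ck_on k U g -> Ck_on k U (f * g).
Proof.
move=> oU; elim: k f g => [|k IH] f g.
  by move=> cf cg x Ux; apply: continuousM; [exact: cf|exact: cg].
move=> kf kg; have [df Df] := kf; have [dg Dg] := kg; split=> [x Ux|i].
  by apply: differentiableM; [exact: df|exact: dg].
apply: (@Ck_on_ext k U (f * 'D_(delta_mx 0 i) g + g * 'D_(delta_mx 0 i) f)) => //.
  by move=> x Ux; rewrite deriveM//; apply: diff_derivable; [exact: df|exact: dg].
by apply: Ck_onD => //; apply: IH; solve [exact: Ck_onW | exact: Df | exact: Dg].
Qed.

End smooth_on.

Record chart (R : realType) (m : nat) (M : topologicalType) := Chart {
  chart_dom : set M;
  chart_cod : set 'rV[R]_m;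
  chart_to : M -> 'rV[R]_m;
  chart_from : 'rV[R]_m -> M;
  chart_dom_open : open chart_dom;
  chart_cod_open : open chart_cod;
  chart_to_cod : forall p, chart_dom p -> chart_cod (chart_to p);
  chart_from_dom : forall x, chart_cod x -> chart_dom (chart_from x);
  chart_toK : forall p, chart_dom p -> chart_from (chart_to p) = p;
  chart_fromK : forall x, chart_cod x -> chart_to (chart_from x) = x;
  chart_to_cont : forall p, chart_dom p -> {for p, continuous chart_to};
  chart_from_cont : forall x, chart_cod x -> {for x, continuous chart_from} }.

Arguments chart_dom_open {R m M} _.
Arguments chart_cod_open {R m M} _.

Definition smooth_compatible (R : realType) (m : nat) (M : topologicalType)
    (a b : chart R m M) : Prop :=
  forall i : 'I_m,
    smooth_on (chart_cod a `&` chart_from a @^-1` chart_dom b)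
              (fun x => chart_to b (chart_from a x) 0 i).

(* The atlas is not required to be maximal: any smooth atlas determines the
   smooth structure. *)
Record manifold (R : realType) (m : nat) := Manifold {
  mfd_carrier :> topologicalType;
  mfd_atlas : set (chart R m mfd_carrier);
  mfd_hausdorff : hausdorff_space mfd_carrier;
  mfd_second_countable : @second_countable mfd_carrier;
  mfd_cover : forall p : mfd_carrier, exists2 c, mfd_atlas c & chart_dom c p;
  mfd_compatible : forall a b, mfd_atlas a -> mfd_atlas b ->
    smooth_compatible a b }.

Section smooth_functions.
Variables (R : realType) (m : nat) (M : manifold R m).

Definition is_smooth (f : M -> R) : Prop := forall c, mfd_atlas c ->
  smooth_on (chart_cod c) (f \o chart_from c).

Definition smooth_pred : {pred M -> R} := [pred f | `[< is_smooth f >]].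

Lemma is_smoothP f : reflect (is_smooth f) (f \in smooth_pred).
Proof. exact: asboolP. Qed.

Lemma is_smooth_cst a : is_smooth (fun=> a).
Proof. by move=> c _ k; apply: Ck_on_cst; exact: chart_cod_open. Qed.

Lemma is_smoothD f g : is_smooth f -> is_smooth g -> is_smooth (f + g).
Proof.
move=> sf sg c Ac k; have oc := chart_cod_open c.
exact: (Ck_onD oc (sf c Ac k) (sg c Ac k)).
Qed.

Lemma is_smoothM f g : is_smooth f -> is_smooth g -> is_smooth (f * g).
Proof.
move=> sf sg c Ac k; have oc := chart_cod_open c.
exact: (Ck_onM oc (sf c Ac k) (sg c Ac k)).
Qed.

Lemma is_smoothZ a f : is_smooth f -> is_smooth (a *: f).
Proof. exact/is_smoothM/is_smooth_cst. Qed.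

Lemma is_smoothB f g : is_smooth f -> is_smooth g -> is_smooth (f - g).
Proof. by move=> sf sg; rewrite -scaleN1r; apply: is_smoothD => //; exact: is_smoothZ. Qed.

Fact smooth_subring_closed : subring_closed smooth_pred.
Proof.
split=> [|f g|f g]; first exact/is_smoothP/is_smooth_cst.
- by move=> /is_smoothP sf /is_smoothP sg; apply/is_smoothP/is_smoothB.
- by move=> /is_smoothP sf /is_smoothP sg; apply/is_smoothP/is_smoothM.
Qed.
HB.instance Definition _ :=
  GRing.isSubringClosed.Build (M -> R) smooth_pred smooth_subring_closed.

Fact smooth_scaler_closed : scaler_closed smooth_pred.
Proof. by move=> a f /is_smoothP sf; apply/is_smoothP/is_smoothZ. Qed.
HB.instance Definition _ :=
  GRing.isScaleClosed.Build R (M -> R) smooth_pred smooth_scaler_closed.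

Record smooth_fun := SmoothFun {
  smooth_fun_val :> M -> R;
  smooth_fun_valP : smooth_fun_val \in smooth_pred }.

HB.instance Definition _ := [isSub for smooth_fun_val].
HB.instance Definition _ := [Choice of smooth_fun by <:].
HB.instance Definition _ :=
  GRing.SubChoice_isSubComPzRing.Build (M -> R) smooth_pred smooth_fun
    smooth_subring_closed.
HB.instance Definition _ := [SubZmodule_isSubLmodule of smooth_fun by <:].

Definition mk_smooth f (sf : is_smooth f) : smooth_fun :=
  SmoothFun (introT (is_smoothP f) sf).

End smooth_functions.

Section tangent.
Variables (R : realType) (m : nat) (M : manifold R m).

(* T_p M is the space of derivations at p of the algebra C^oo(M). *)
Definition is_derivation_at (p : M) (v : smooth_fun M -> R) : Prop :=
  scalar v /\ (forall f g : smooth_fun M, v (f * g) = f p * v g + g p * v f).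

Definition tangent_pred (p : M) : {pred smooth_fun M -> R} :=
  [pred v | `[< is_derivation_at p v >]].

Lemma is_derivation_atP p v :
  reflect (is_derivation_at p v) (v \in tangent_pred p).
Proof. exact: asboolP. Qed.

Lemma is_derivation_at0 p : is_derivation_at p (fun=> 0).
Proof. by split=> [a f g|f g]; rewrite /= !mulr0 addr0. Qed.

Lemma is_derivation_at_lin p a v w : is_derivation_at p v ->
  is_derivation_at p w -> is_derivation_at p (a *: v + w).
Proof.
move=> [lv dv] [lw dw]; split=> [b f g|f g]; rewrite /= !fctE.
  by rewrite lv lw /GRing.scale /=; ring.
by rewrite dv dw /GRing.scale /=; ring.
Qed.

Fact tangent_submod_closed p : submod_closed (tangent_pred p).
Proof.
split=> [|a v w].
  exact/is_derivation_atP/is_derivation_at0.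
move=> /is_derivation_atP dv /is_derivation_atP dw.
exact/is_derivation_atP/is_derivation_at_lin.
Qed.
HB.instance Definition _ p :=
  GRing.isSubmodClosed.Build R (smooth_fun M -> R) (tangent_pred p)
    (tangent_submod_closed p).

Record tangent (p : M) := Tangent {
  tangent_val :> smooth_fun M -> R;
  tangent_valP : tangent_val \in tangent_pred p }.

HB.instance Definition _ p := [isSub for @tangent_val p].
HB.instance Definition _ p := [Choice of tangent p by <:].
HB.instance Definition _ p := [SubChoice_isSubLmodule of tangent p by <:].

(* A smooth vector field is a section X_p \in T_p M such that p |-> X_p f is
   smooth for every smooth f.  The section is stored as a plain function of p
   and f, so that the R-module structure comes from the function space. *)
Definition is_vfield (X : M -> smooth_fun M -> R) : Prop :=
  (forall p, is_derivation_at p (X p)) /\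
  (forall f, is_smooth (fun p => X p f)).

Definition vfield_pred : {pred M -> smooth_fun M -> R} :=
  [pred X | `[< is_vfield X >]].

Lemma is_vfieldP X : reflect (is_vfield X) (X \in vfield_pred).
Proof. exact: asboolP. Qed.

Fact vfield_submod_closed : submod_closed vfield_pred.
Proof.
split=> [|a X Y].
  apply/is_vfieldP; split=> [p|f]; last exact: is_smooth_cst.
  exact: is_derivation_at0.
move=> /is_vfieldP[dX sX] /is_vfieldP[dY sY]; apply/is_vfieldP; split=> [p|f].
  exact: is_derivation_at_lin.
by apply: is_smoothD (sY f); exact/is_smoothZ/(sX f).
Qed.
HB.instance Definition _ :=
  GRing.isSubmodClosed.Build R (M -> smooth_fun M -> R) vfield_pred
    vfield_submod_closed.

Record vfield := VField {
  vfield_val : M -> smooth_fun M -> R;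
  vfield_valP : vfield_val \in vfield_pred }.

HB.instance Definition _ := [isSub for vfield_val].
HB.instance Definition _ := [Choice of vfield by <:].
HB.instance Definition _ := [SubChoice_isSubLmodule of vfield by <:].

Definition mk_vfield X (vX : is_vfield X) : vfield :=
  VField (introT (is_vfieldP X) vX).

Lemma vfieldP (X : vfield) : is_vfield (vfield_val X).
Proof. exact/is_vfieldP/vfield_valP. Qed.

Definition vf_at (X : vfield) (p : M) : tangent p :=
  Tangent (introT (is_derivation_atP p _) ((vfieldP X).1 p)).

Definition is_smooth_section (s : forall p, tangent p) : Prop :=
  forall f, is_smooth (fun p => s p f).

Lemma is_vfield_section s : is_smooth_section s ->
  is_vfield (fun p => tangent_val (s p)).
Proof. by move=> ss; split=> // p; exact/is_derivation_atP/tangent_valP. Qed.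

Definition vf_of_section s (ss : is_smooth_section s) : vfield :=
  mk_vfield (is_vfield_section ss).

Definition vf_act (X : vfield) (f : smooth_fun M) : smooth_fun M :=
  mk_smooth ((vfieldP X).2 f).

Lemma is_smooth_section_fscale (f : smooth_fun M) (X : vfield) :
  is_smooth_section (fun p => f p *: vf_at X p).
Proof.
by move=> h; apply: is_smoothM ((vfieldP X).2 h); exact/is_smoothP/smooth_fun_valP.
Qed.

Definition vf_fscale f X : vfield := vf_of_section (@is_smooth_section_fscale f X).

Lemma is_vfield_bracket (X Y : vfield) :
  is_vfield (fun p f => vf_at X p (vf_act Y f) - vf_at Y p (vf_act X f)).
Proof.
have act_lin (Z : vfield) a f g : vf_act Z (a *: f + g) = a *: vf_act Z f + vf_act Z g.
  by apply/val_inj/funext => q; exact: (((vfieldP Z).1 q).1 a f g).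
have actM (Z : vfield) f g : vf_act Z (f * g) = f * vf_act Z g + g * vf_act Z f.
  by apply/val_inj/funext => q; exact: (((vfieldP Z).1 q).2 f g).
have atD (Z : vfield) p f g : vf_at Z p (f + g) = vf_at Z p f + vf_at Z p g.
  by have := ((vfieldP Z).1 p).1 1 f g; rewrite scale1r mul1r.
split=> [p|f]; last first.
  by apply: is_smoothB; [exact: ((vfieldP X).2 (vf_act Y f))
                        |exact: ((vfieldP Y).2 (vf_act X f))].
split=> [a f g|f g].
  have linX := ((vfieldP X).1 p).1; have linY := ((vfieldP Y).1 p).1.
  rewrite !act_lin /= linX linY /= mulrBr opprD addrACA //.
rewrite !actM !atD.
have dX := ((vfieldP X).1 p).2; have dY := ((vfieldP Y).1 p).2.
rewrite /= !dX !dY /=.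
set a := vfield_val X p _; set b := vfield_val X p _.
set c := vfield_val X p _; set d := vfield_val X p _.
ring.
Qed.

Definition lie_bracket (X Y : vfield) : vfield := mk_vfield (is_vfield_bracket X Y).

End tangent.

Definition is_basis_of (R : realType) (V : lmodType R) (k : nat) (S : set V)
    (e : 'I_k -> V) : Prop :=
  (forall c : 'I_k -> R, \sum_i c i *: e i = 0 -> forall i, c i = 0) /\
  S = [set v | exists c : 'I_k -> R, v = \sum_i c i *: e i].

Section tensors.
Variables (R : realType) (m : nat) (M : manifold R m).

(* (1,1)-tensor field: fibrewise endomorphisms taking smooth vector fields to
   smooth vector fields. *)
Record endo_field := EndoField {
  endo_at :> forall p : M, {linear tangent p -> tangent p};
  endo_smooth : forall X : vfield M,
    is_smooth_section (fun p => endo_at p (vf_at X p)) }.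

Definition endo_app (P : endo_field) (X : vfield M) : vfield M :=
  vf_of_section (@endo_smooth P X).

Record metric := Metric {
  metric_at :> forall p : M, tangent p -> tangent p -> R;
  metric_lin : forall p (w : tangent p), scalar (fun v => metric_at v w);
  metric_sym : forall p (v w : tangent p), metric_at v w = metric_at w v;
  metric_nondeg : forall p (v : tangent p),
    (forall w, metric_at v w = 0) -> v = 0;
  metric_smooth : forall X Y : vfield M,
    is_smooth (fun p => metric_at (vf_at X p) (vf_at Y p)) }.

Definition metric_app (g : metric) (X Y : vfield M) : smooth_fun M :=
  mk_smooth (@metric_smooth g X Y).

Definition neutral_signature (n : nat) (g : metric) : Prop :=
  forall p : M, exists2 e : 'I_(n + n) -> tangent p,
    is_basis_of setT e &
    forall i j, g p (e i) (e j) =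
      if i == j then (if (i < n)%N then 1 else -1) else 0.

Definition almost_paraHermitian (n : nat) (g : metric) (P : endo_field) : Prop :=
  [/\ forall p (v : tangent p), P p (P p v) = v,
      forall p, exists e : 'I_n -> tangent p,
        is_basis_of [set v | P p v = v] e,
      forall p, exists e : 'I_n -> tangent p,
        is_basis_of [set v | P p v = - v] e,
      neutral_signature n g &
      forall p (v w : tangent p), g p (P p v) w + g p v (P p w) = 0].

(* R-homogeneity in the second argument is the Leibniz rule for constant f. *)
Definition is_connection (D : vfield M -> vfield M -> vfield M) : Prop :=
  [/\ forall f X X' Y, D (vf_fscale f X + X') Y = vf_fscale f (D X Y) + D X' Y,
      forall X Y Y', D X (Y + Y') = D X Y + D X Y' &
      forall f X Y, D X (vf_fscale f Y) =
        vf_fscale (vf_act X f) Y + vf_fscale f (D X Y)].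

Definition torsion (D : vfield M -> vfield M -> vfield M) (X Y : vfield M) : vfield M :=
  D X Y - D Y X - lie_bracket X Y.

Definition levi_civita (g : metric) (D : vfield M -> vfield M -> vfield M) : Prop :=
  [/\ is_connection D,
      forall X Y, torsion D X Y = 0 &
      forall X Y Z, vf_act X (metric_app g Y Z) =
        metric_app g (D X Y) Z + metric_app g Y (D X Z)].

Definition cov_endo (D : vfield M -> vfield M -> vfield M) (P : endo_field)
    (X Y : vfield M) : vfield M :=
  D X (endo_app P Y) - endo_app P (D X Y).

(* (nabla_X B)(Y, Z) for a vector-valued (0,2)-tensor B. *)
Definition cov_bilin (D B : vfield M -> vfield M -> vfield M) (X Y Z : vfield M) : vfield M :=
  D X (B Y Z) - B (D X Y) Z - B Y (D X Z).

(* D is meant to be the Levi-Civita connection of g. *)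
Definition nearly_paraKahler (n : nat) (g : metric) (P : endo_field)
    (D : vfield M -> vfield M -> vfield M) : Prop :=
  [/\ almost_paraHermitian n g P,
      ~ (forall X Y, cov_endo D P X Y = 0) &
      forall X, cov_endo D P X X = 0].

Definition nijenhuis (P : endo_field) (X Y : vfield M) : vfield M :=
  4%:R^-1 *: (lie_bracket (endo_app P X) (endo_app P Y) + lie_bracket X Y
              - endo_app P (lie_bracket (endo_app P X) Y)
              - endo_app P (lie_bracket X (endo_app P Y))).

Definition canonical_connection (D : vfield M -> vfield M -> vfield M) (P : endo_field)
    (X Y : vfield M) : vfield M :=
  D X Y - 2%:R^-1 *: cov_endo D P X (endo_app P Y).

End tensors.

(* Main.v *)
Require Import Defs.
From HB Require Import structures.
From mathcomp Require Import all_boot all_order all_algebra.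
From mathcomp Require Import all_classical all_reals all_analysis.
From mathcomp Require Import ring.

(* Write A for the covariant derivative of P with respect to the Levi-Civita
   connection.  The nearly paraKaehler condition makes T = P A totally
   skew-symmetric; T is the torsion of the canonical connection nabla and equals
   -N.  Since T(PX, Y) = -P T(X, Y), T vanishes on pairs of eigenvectors of P of
   different types and maps V+ x V+ to V-, V- x V- to V+, where the eigenbundles
   V+, V- are g-isotropic.  The curvature R of nabla preserves V+ and V-, so the
   first Bianchi identity with torsion, paired with a fourth eigenvector, reduces
   to two statements.  For Y, Z, W of one type and X of the other,
   g(R(Y, Z)X, W) = g((nabla_X T)(Y, Z), W), and the cyclic sum of the left-hand
   side over Y, Z, W vanishes.  For X, Y, Z, W of the same type, the cyclic sum
   over X, Y, Z of g((nabla_X T)(Y, Z), W) vanishes.  As this expression is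
   totally skew in Y, Z, W, both cases give nabla T = 0.

   Nondegeneracy of g is a pointwise condition, so testing against global vector
   fields requires every tangent vector to extend to one; the extensions are
   combinations of coordinate fields cut off by a bump function. *)

Set Implicit Arguments.
Unset Strict Implicit.
Unset Printing Implicit Defensive.

Import Order.TTheory GRing.Theory Num.Theory.
Import numFieldNormedType.Exports.

Local Open Scope classical_set_scope.
Local Open Scope ring_scope.

(** * Functions of class C^k *)

Section Ck_on_calculus.
Variables (R : realType) (m : nat).
Implicit Types (U V : set 'rV[R]_m) (f g : 'rV[R]_m -> R) (k : nat).

(** [Ck_on] imposes its conditions point by point, so regularity may be checked on a different piece
    around each point. This glues the cut-off functions below. *)
Lemma Ck_on_local k U f :
  (forall x, U x -> exists V, V x /\ Ck_on k V f) -> Ck_on k U f.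
Proof.
elim: k f => [|k IH] f /= loc.
  by move=> x Ux; have [V [Vx cf]] := loc x Ux; exact: cf.
split=> [x Ux|i]; first by have [V [Vx [df _]]] := loc x Ux; exact: df.
by apply: IH => x Ux; have [V [Vx [_ Df]]] := loc x Ux; exists V.
Qed.

Lemma Ck_on_sum k U n (F : 'I_n -> 'rV[R]_m -> R) : open U ->
  (forall i, Ck_on k U (F i)) -> Ck_on k U (\sum_i F i).
Proof.
move=> oU sF; elim/big_ind : _ => //; first exact: Ck_on_cst.
by move=> f g; exact: Ck_onD.
Qed.

Lemma smooth_on_derive U f i : smooth_on U f ->
  smooth_on U ('D_(delta_mx 0 i) f).
Proof. by move=> sf k; exact: (sf k.+1).2. Qed.

Lemma smooth_on_differentiable U f x : smooth_on U f -> U x ->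
  differentiable f x.
Proof. by move=> /(_ 1)[df _]; exact: df. Qed.

Lemma derive_coord (i j : 'I_m) (x : 'rV[R]_m) :
  'D_(delta_mx 0 j) (fun x : 'rV[R]_m => x 0 i) x = (i == j)%:R.
Proof.
rewrite deriveE; last exact: differentiable_coord.
have lc : linear (fun x : 'rV[R]_m => x 0 i : R).
  by move=> a u v; rewrite !mxE.
pose c : {linear 'rV[R]_m -> R} := HB.pack (fun x : 'rV[R]_m => x 0 i : R)
   (GRing.isLinear.Build _ _ _ _ _ lc).
by rewrite (@diff_lin _ _ _ c) /= ?mxE ?eqxx//; exact: coord_continuous.
Qed.

Lemma Ck_on_coord k U i : open U -> Ck_on k U (fun x : 'rV[R]_m => x 0 i).
Proof.
move=> oU; case: k => [|k] /=; first by move=> x _; exact: coord_continuous.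
split=> [x _|j]; first exact: differentiable_coord.
apply: (@Ck_on_ext _ _ _ _ (cst (i == j)%:R)) => // [x _|].
  by rewrite derive_coord.
exact: Ck_on_cst.
Qed.

Lemma Ck_onN k U f : open U -> Ck_on k U f -> Ck_on k U (- f).
Proof.
move=> oU sf; apply: (@Ck_on_ext _ _ _ _ (cst (-1) * f)) => //.
  by move=> x _; rewrite /= !fctE mulN1r.
by apply: Ck_onM => //; exact: Ck_on_cst.
Qed.

Section composition.
Variables (U W : set 'rV[R]_m) (phi : 'rV[R]_m -> 'rV[R]_m).
Hypotheses (oU : open U) (phiUW : forall x, U x -> W (phi x)).
Hypothesis sphi : forall i, smooth_on U (fun x => phi x 0 i).

Lemma coord_sumE : phi = \sum_i (fun x => phi x 0 i *: delta_mx 0 i).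
Proof.
apply/funext => x; rewrite fct_sumE; apply/rowP => j.
rewrite summxE (bigD1 j)//= big1 ?addr0 ?mxE ?eqxx ?mulr1//.
by move=> i ij; rewrite !mxE eqxx eq_sym (negbTE ij) mulr0.
Qed.

Lemma coord_differentiable x : U x -> differentiable phi x.
Proof.
move=> Ux; rewrite coord_sumE; apply: differentiable_sum => i.
by apply: differentiableZl; exact: (smooth_on_differentiable (sphi i) Ux).
Qed.

Lemma derive_comp_sum f v x : U x -> differentiable f (phi x) ->
  'D_v (f \o phi) x = \sum_i 'D_(delta_mx 0 i) f (phi x) * 'D_v (fun y => phi y 0 i) x.
Proof.
move=> Ux df; have dphi := coord_differentiable Ux.
rewrite deriveE; last exact: differentiable_comp.
rewrite diff_comp//= -(deriveE _ dphi) derive_mx; last exact: diff_derivable.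
set w := \matrix_(_, _) _.
rewrite [w]row_sum_delta linear_sum; apply: eq_bigr => i _.
by rewrite linearZ /= -deriveE// /w mxE mulrC.
Qed.

(** By the chain rule a partial derivative of [f \o phi] is a sum of products of smooth functions
    with partial derivatives of [f] composed with [phi], to which the induction hypothesis
    applies. *)
Lemma Ck_on_comp k f : Ck_on k W f -> Ck_on k U (f \o phi).
Proof.
elim: k f => [|k IH] f.
  move=> cf x Ux; apply: continuous_comp.
    exact/differentiable_continuous/coord_differentiable.
  exact/cf/phiUW.
move=> [df Df]; split=> [x Ux|j].
  apply: differentiable_comp; first exact: coord_differentiable.
  exact/df/phiUW.
apply: (@Ck_on_ext _ _ _ _ (\sum_i (('D_(delta_mx 0 i) f \o phi) *
    'D_(delta_mx 0 j) (fun y => phi y 0 i)))) => //.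
  move=> x Ux; rewrite fct_sumE derive_comp_sum//.
  exact/df/phiUW.
apply: Ck_on_sum => // i; apply: Ck_onM => //; first exact/IH/Df.
exact: smooth_on_derive.
Qed.

End composition.
End Ck_on_calculus.

(** * The functions t^(-n) exp(-1/t), extended by zero *)

Section flat.
Variable R : realType.
Implicit Types (t : R) (n : nat).

(* Up to linear combinations the family is closed under differentiation, so the
   [C^k] regularity of all its members follows by one induction on [k]. *)
Definition flat n t : R := if 0 < t then t^-1 ^+ n * expR (- t^-1) else 0.

Lemma flat_gt0 n t : 0 < t -> 0 < flat n t.
Proof.
by move=> t0; rewrite /flat t0 mulr_gt0 ?expR_gt0// exprn_gt0// invr_gt0.
Qed.

Lemma flat_le0 n t : t <= 0 -> flat n t = 0.
Proof. by rewrite /flat ltNge => ->. Qed.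

Lemma flat_ge0 n t : 0 <= flat n t.
Proof. by case: (ltP 0 t) => [/flat_gt0 /ltW|/flat_le0 ->]. Qed.

(** The exponential at [t^-1] exceeds its Taylor term of degree [n.+2]. The two spare powers of [t]
    yield the derivative at 0. *)
Lemma flat_le_sqr n t : flat n t <= n.+2`!%:R * t ^+ 2.
Proof.
rewrite /flat; case: ifPn => [t0|_]; last by rewrite mulr_ge0 ?sqr_ge0.
rewrite expRN ler_pdivrMr ?expR_gt0// mulrAC.
have x0 : 0 <= t^-1 by rewrite invr_ge0 ltW.
have := expR_ge1Dxn n.+1 x0.
have fpos : 0 < n.+2`!%:R :> R by rewrite ltr0n fact_gt0.
move=> /(le_trans (ler_wpDl ler01 (lexx _))).
rewrite ler_pdivrMr// mulrC => /(ler_wpM2r (sqr_ge0 t)); apply: le_trans.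
by rewrite -addn2 exprD -mulrA -exprMn mulVf ?gt_eqF// expr1n mulr1.
Qed.

(** For positive [t] this is the product rule, and for negative [t] everything vanishes. At 0 the
    quadratic bound forces the difference quotient to tend to 0. *)
Lemma is_derive_flat n t : is_derive t 1 (flat n) (flat n.+2 t - n%:R * flat n.+1 t).
Proof.
case: (ltrgtP t 0) => [t0|t0|->].
- rewrite !flat_le0 ?ltW// mulr0 subr0.
  apply: (@near_eq_is_derive _ _ _ (cst 0)).
  by near=> s; rewrite flat_le0//; apply: ltW; near: s; exact: lt_nbhsl.
- have dV : is_derive t 1 (fun s : R => s^-1) (- t ^- 2 *: 1).
    by apply: is_deriveV; rewrite gt_eqF.
  have dF : is_derive t 1 ((fun s => s^-1) ^+ n * (expR \o (fun s => - s^-1)))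
      (flat n.+2 t - n%:R * flat n.+1 t).
    apply: is_derive_eq; rewrite /flat t0 /= /GRing.scale /= !exprfctE.
    by case: n => [|n] /=; rewrite !exprS; field; rewrite gt_eqF.
  apply: near_eq_is_derive dF; near=> s; rewrite /= fctE /flat.
  have -> : 0 < s by near: s; exact: lt_nbhsr.
  by rewrite exprfctE.
- rewrite !flat_le0// mulr0 subr0.
  have lim0 : h^-1 *: (flat n (h *: 1 + 0) - flat n 0) @[h --> 0^'] --> (0 : R).
    apply/cvgrPdist_le => e e0; near=> h.
    rewrite sub0r normrN addr0 (flat_le0 _ (lexx 0)) subr0 normrZ [h%:A]mulr1.
    rewrite (ger0_norm (flat_ge0 _ _)) normfV.
    have h0 : h != 0 by near: h; exact: nbhs_dnbhs_neq.
    rewrite ler_pdivrMl ?normr_gt0// (le_trans (flat_le_sqr _ _))//.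
    have -> : h ^+ 2 = `|h| * `|h| by rewrite -expr2 -normrX ger0_norm ?sqr_ge0.
    rewrite mulrCA.
    rewrite ler_wpM2l ?normr_ge0// mulrC -ler_pdivlMr ?ltr0n ?fact_gt0//.
    near: h; apply: dnbhs0_le; rewrite divr_gt0// ltr0n fact_gt0//.
  split; first by apply/cvg_ex; exists 0.
  exact/cvg_lim.
Unshelve. all: by end_near. Qed.

Lemma Ck_on_flat m k n (U : set 'rV[R]_m) u : open U ->
  Ck_on k U u -> Ck_on k U (flat n \o u).
Proof.
move=> oU; elim: k n u => [|k IH] n u.
  move=> cu x Ux; apply: continuous_comp; first exact: cu.
  apply/differentiable_continuous/derivable1_diffP.
  exact: @ex_derive _ _ _ _ _ _ _ (is_derive_flat n (u x)).
move=> su; have [du Du] := su.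
have dflat s : differentiable (flat n) s.
  by apply/derivable1_diffP; exact: @ex_derive _ _ _ _ _ _ _ (is_derive_flat n s).
split=> [x Ux|i]; first exact: differentiable_comp (du x Ux) (dflat _).
apply: (@Ck_on_ext _ _ _ _ ((flat n.+2 \o u + - (cst n%:R * (flat n.+1 \o u))) *
  'D_(delta_mx 0 i) u)) => //.
  move=> x Ux; rewrite [RHS]deriveE; last exact: differentiable_comp (du x Ux) (dflat _).
  rewrite diff_comp//=; last exact: du.
  rewrite -(deriveE _ (du x Ux)) diff1E//.
  have := is_derive_flat n (u x) => /(@derive_val _ _ _ _ _ _ _).
  by rewrite derive1E => ->; rewrite /GRing.scale /= mulrC.
have su' := Ck_onW su.
apply: Ck_onM => //; last exact: Du.
apply: Ck_onD; [exact: oU|exact: IH|apply: Ck_onN => //].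
by apply: Ck_onM => //; [exact: Ck_on_cst|exact: IH].
Qed.

End flat.

(** * Bump functions *)

Section bump.
Variables (R : realType) (m : nat) (a : 'rV[R]_m) (r : R).
Hypothesis r0 : 0 < r.

(** The Euclidean distance is chosen because its square is smooth. It dominates the maximum norm of
    ['rV[R]_m], so the function still vanishes outside [closed_ball a r]. *)
Definition bump (x : 'rV[R]_m) : R :=
  flat 0 (r ^+ 2 - \sum_i (x 0 i - a 0 i) ^+ 2).

Lemma bump_center : 0 < bump a.
Proof.
apply: flat_gt0; rewrite big1 ?subr0 ?exprn_gt0// => i _.
by rewrite subrr expr0n.
Qed.

Lemma bump_out x : ~ closed_ball a r x -> bump x = 0.
Proof.
move=> xr; apply: flat_le0; rewrite leNgt; apply/negP => lt; apply: xr.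
rewrite closed_ballE//= /closed_ball_ /= /Num.Def.normr /= mx_normrE.
apply: bigmax_le => [|[i j] _ /=]; first exact: ltW.
rewrite ord1 !mxE distrC -(@ler_pXn2r _ 2)// ?nnegrE ?(ltW r0)//.
rewrite -normrX ger0_norm ?sqr_ge0//.
move: lt; rewrite subr_gt0 (bigD1 j)//= => lt.
apply/ltW/(le_lt_trans _ lt); rewrite lerDl.
by apply: sumr_ge0 => k _; exact: sqr_ge0.
Qed.

Lemma smooth_on_bump U : open U -> smooth_on U bump.
Proof.
move=> oU k; apply: (Ck_on_flat 0 oU).
pose d i : 'rV[R]_m -> R := (fun x => x 0 i) + - cst (a 0 i).
apply: (@Ck_on_ext _ _ _ _ (cst (r ^+ 2) + - \sum_i (d i * d i))) => //.
  by move=> x _; rewrite /= !fctE fct_sumE.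
apply: Ck_onD => //; first exact: Ck_on_cst.
apply: Ck_onN => //; apply: Ck_on_sum => // i.
suff : Ck_on k U (d i) by move=> ?; exact: Ck_onM.
apply: Ck_onD => //; first exact: Ck_on_coord.
by apply: Ck_onN => //; exact: Ck_on_cst.
Qed.

End bump.

(** * Extension of tangent vectors to vector fields *)

Section charts.
Variables (R : realType) (m : nat) (M : manifold R m).
Implicit Types (c d : chart R m M).

Lemma chart_preimage_open d (O : set M) : open O ->
  open (chart_cod d `&` chart_from d @^-1` O).
Proof.
move=> oO; rewrite openE => x [Cx Ox]; apply: filterI.
  exact: open_nbhs_nbhs (conj (chart_cod_open d) Cx).
by apply: (chart_from_cont Cx); exact: open_nbhs_nbhs (conj oO Ox).
Qed.

Section cutoff.
Variables (c : chart R m M) (a : 'rV[R]_m) (r : R).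

Definition cutoff (phi : 'rV[R]_m -> R) (p : M) : R :=
  if `[< chart_dom c p >] then bump a r (chart_to c p) * phi (chart_to c p)
  else 0.

Hypotheses (Ac : mfd_atlas c) (r0 : 0 < r).
Hypothesis ballc : closed_ball a r `<=` chart_cod c.

(** The image of a compact ball is compact, hence closed because [M] is Hausdorff. *)
Lemma cutoff_support_closed : closed (chart_from c @` closed_ball a r).
Proof.
apply: compact_closed; first exact: mfd_hausdorff.
apply: continuous_compact.
  apply: continuous_in_subspaceT => x; rewrite inE => /ballc.
  exact: chart_from_cont.
apply: bounded_closed_compact; last exact: closed_ball_closed.
rewrite closed_ballE//; exists (`|a| + r); split; first exact: num_real.
move=> K aK x; rewrite /closed_ball_ /= => axr; apply/ltW/(le_lt_trans _ aK).
have -> : x = a - (a - x) by rewrite opprB addrCA subrr addr0.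
by rewrite (le_trans (ler_normB _ _))// lerD2l.
Qed.

(** In a chart [d], two open sets suffice: the overlap with [c], where a smooth function is composed
    with a transition map, and the complement of the image of the ball, where the function is
    zero. *)
Lemma is_smooth_cutoff phi : smooth_on (chart_cod c) phi -> is_smooth (cutoff phi).
Proof.
move=> sphi d Ad k; apply: Ck_on_local => x dx.
have [cx|ncx] := pselect (chart_dom c (chart_from d x)).
  exists (chart_cod d `&` chart_from d @^-1` chart_dom c); split=> //.
  have oV := chart_preimage_open (d := d) (chart_dom_open c).
  apply: (@Ck_on_ext _ _ _ _ ((bump a r * phi) \o (chart_to c \o chart_from d))) => //.
    by move=> y [_ /= cy]; rewrite /cutoff asboolT.
  apply: (@Ck_on_comp _ _ _ (chart_cod c)) => //.
  - by move=> y [_ cy]; exact: chart_to_cod.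
  - exact: mfd_compatible Ad Ac.
  - have oc := chart_cod_open c.
    by apply: Ck_onM => //; exact: smooth_on_bump.
have oV := chart_preimage_open (d := d) (closed_openC cutoff_support_closed).
exists (chart_cod d `&` chart_from d @^-1` ~` (chart_from c @` closed_ball a r)).
split.
  split=> // -[y /ballc /chart_from_dom cy yx]; apply: ncx.
  by rewrite -yx.
apply: (@Ck_on_ext _ _ _ _ (cst 0)) => //; last exact: Ck_on_cst.
move=> y [dy ny]; rewrite /cutoff /=; case: asboolP => // cy.
rewrite bump_out ?mul0r// => by_; apply: ny.
by exists (chart_to c (chart_from d y)) => //; exact: chart_toK.
Qed.

Lemma smooth_fun_chart (f : smooth_fun M) :
  smooth_on (chart_cod c) (f \o chart_from c).
Proof. exact: (is_smoothP _ (smooth_fun_valP f)) Ac. Qed.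

(** The [j]-th coordinate vector field of [c], multiplied by the bump function and extended by
    zero. *)
Definition cutoff_partial (j : 'I_m) (p : M) (f : smooth_fun M) : R :=
  cutoff ('D_(delta_mx 0 j) (f \o chart_from c)) p.

Lemma is_vfield_cutoff_partial j : is_vfield (cutoff_partial j).
Proof.
split=> [p|f]; last first.
  exact/is_smooth_cutoff/smooth_on_derive/smooth_fun_chart.
rewrite /cutoff_partial /cutoff; case: asboolP => cp; last exact: is_derivation_at0.
have cx := chart_to_cod cp.
have df (f : smooth_fun M) v : derivable (f \o chart_from c) (chart_to c p) v.
  exact: diff_derivable (smooth_on_differentiable (smooth_fun_chart f) cx).
split=> [b f g|f g].
  have -> : (b *: f + g : smooth_fun M) \o chart_from c =
     b *: (f \o chart_from c) + (g \o chart_from c) by [].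
  rewrite deriveD; [|exact/derivableZ/df|exact: df].
  by rewrite deriveZ; [rewrite /= /GRing.scale /=; ring|exact: df].
have -> : (f * g : smooth_fun M) \o chart_from c =
   (f \o chart_from c) * (g \o chart_from c) by [].
rewrite deriveM; [|exact: df|exact: df].
by rewrite /= chart_toK// /GRing.scale /=; ring.
Qed.

Definition cutoff_coord (i : 'I_m) : 'rV[R]_m -> R := fun x => x 0 i - a 0 i.

Lemma smooth_on_cutoff_coord i : smooth_on (chart_cod c) (cutoff_coord i).
Proof.
move=> k; apply: (@Ck_onD _ _ _ _ (fun x => x 0 i) (cst (- a 0 i))).
- exact: chart_cod_open.
- exact/Ck_on_coord/chart_cod_open.
- exact/Ck_on_cst/chart_cod_open.
Qed.

(** One factor [bump a r a] comes from the field, the other from the cut-off coordinate. The term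
    with the derivative of the bump drops out because [cutoff_coord] vanishes at [a]. *)
Lemma cutoff_partial_coord (i j : 'I_m) p : chart_dom c p -> chart_to c p = a ->
  cutoff_partial j p (mk_smooth (is_smooth_cutoff (smooth_on_cutoff_coord i))) =
  bump a r a ^+ 2 * (i == j)%:R.
Proof.
move=> cp cpa; rewrite /cutoff_partial {1}/cutoff asboolT// cpa.
have ca : chart_cod c a by rewrite -cpa; exact: chart_to_cod.
rewrite expr2 -mulrA; congr (_ * _).
have dc : differentiable (cutoff_coord i) a.
  exact: smooth_on_differentiable (smooth_on_cutoff_coord i) ca.
have db : differentiable (bump a r) a.
  by apply: smooth_on_differentiable ca; exact/smooth_on_bump/chart_cod_open.
rewrite (@near_eq_derive _ _ _ _ (bump a r * cutoff_coord i)); last first.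
  apply: filterS (open_nbhs_nbhs (conj (chart_cod_open c) ca)) => x cx.
  by rewrite /= /cutoff asboolT ?chart_fromK//; exact: chart_from_dom.
rewrite deriveM; [|exact: diff_derivable|exact: diff_derivable].
rewrite {2}/cutoff_coord subrr scale0r addr0 /GRing.scale /=; congr (_ * _).
rewrite (_ : cutoff_coord i = (fun x : 'rV[R]_m => x 0 i) + cst (- a 0 i))//.
rewrite deriveD; last 2 first.
- exact/diff_derivable/differentiable_coord.
- exact: derivable_cst.
by rewrite derive_cst addr0 derive_coord.
Qed.

End cutoff.
End charts.

(** The coefficients of [E] in the basis [e] form a square matrix with a right inverse built from
    the functionals [l]. This inverse is two-sided, so it expresses [e] through [E]. *)
Lemma dual_family_spans (R : realType) (V : lmodType R) (m : nat)
    (e E : 'I_m -> V) (l : 'I_m -> {scalar V}) (b : R) :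
  is_basis_of setT e -> b != 0 ->
  (forall i j, l i (E j) = b * (i == j)%:R) ->
  forall v, exists x : 'I_m -> R, v = \sum_j x j *: E j.
Proof.
move=> [_ eT] b0 lE.
have span v : exists x : 'I_m -> R, v = \sum_i x i *: e i.
  by have : setT v by []; rewrite eT.
have /choice[A EA] : forall j, exists x : 'I_m -> R, E j = \sum_i x i *: e i.
  by move=> j; exact: span.
pose MA := \matrix_(j, k) A j k; pose MB := \matrix_(k, i) (b^-1 * l i (e k)).
have AB : MA *m MB = 1%:M.
  apply/matrixP => j i; rewrite !mxE.
  transitivity (b^-1 * l i (E j)).
    rewrite EA linear_sum mulr_sumr; apply: eq_bigr => k _.
    by rewrite !mxE linearZ /= mulrCA.
  by rewrite lE mulrA mulVf// mul1r eq_sym.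
have BA := mulmx1C AB.
have eE k : e k = \sum_j MB k j *: E j.
  under eq_bigr do rewrite EA scaler_sumr.
  rewrite exchange_big /=.
  transitivity (\sum_i (MB *m MA) k i *: e i).
    rewrite BA (bigD1 k)//= big1 ?addr0 ?mxE ?eqxx ?scale1r// => i ik.
    by rewrite mxE eq_sym (negbTE ik) scale0r.
  apply: eq_bigr => i _; rewrite mxE scaler_suml; apply: eq_bigr => j _.
  by rewrite scalerA [MA j i]mxE.
move=> v; have [x ->] := span v.
exists (fun j => \sum_k x k * MB k j).
under [RHS]eq_bigr do rewrite scaler_suml.
rewrite exchange_big; apply: eq_bigr => k _ /=.
by rewrite eE scaler_sumr; apply: eq_bigr => j _; rewrite scalerA.
Qed.

Section extension.
Variables (R : realType) (m : nat) (M : manifold R m).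

(** [vf_at] with the point first, so that evaluation at a fixed point can carry a linear
    structure. *)
Definition vf_eval (p : M) (X : vfield M) : tangent p := vf_at X p.

Lemma vf_eval_linear (p : M) : linear (vf_eval p).
Proof. by move=> a X Y; exact: val_inj. Qed.
HB.instance Definition _ (p : M) :=
  GRing.isLinear.Build R (vfield M) (tangent p) _ (vf_eval p) (vf_eval_linear p).

Definition tangent_act (p : M) (f : smooth_fun M) (v : tangent p) : R := v f.

Lemma tangent_act_scalar (p : M) (f : smooth_fun M) : scalar (@tangent_act p f).
Proof. by []. Qed.
HB.instance Definition _ (p : M) (f : smooth_fun M) :=
  GRing.isLinear.Build R (tangent p) R _ (@tangent_act p f)
    (@tangent_act_scalar p f).

(* Tangent vectors are derivations of global functions, so the extension needs
   that the cut-off partial derivatives span; with the dimension of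
   the tangent space given, this follows from their linear independence. *)
Lemma tangent_extends (p : M) (e : 'I_m -> tangent p) (w : tangent p) :
  is_basis_of setT e -> exists W : vfield M, vf_at W p = w.
Proof.
move=> eT; have [c Ac cp] := mfd_cover p.
pose a := chart_to c p; have ca : chart_cod c a by exact: chart_to_cod.
have [r r0 rc] : exists2 r : R, 0 < r & closed_ball a r `<=` chart_cod c.
  have := open_nbhs_nbhs (conj (chart_cod_open c) ca).
  by move=> /nbhs_closedballP[r rc]; exists r%:num.
pose E j := mk_vfield (is_vfield_cutoff_partial Ac r0 rc j).
pose f i := mk_smooth (is_smooth_cutoff Ac r0 rc (@smooth_on_cutoff_coord _ _ _ c a i)).
have b0 : bump a r a ^+ 2 != 0 by rewrite expf_neq0// gt_eqF// bump_center.
have [|x ->] := @dual_family_spans _ _ _ e (fun j => vf_eval p (E j))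
  (fun i => @tangent_act p (f i)) _ eT b0 _ w.
  by move=> i j; exact: cutoff_partial_coord.
exists (\sum_j x j *: E j); rewrite -/(vf_eval p _) linear_sum.
by apply: eq_bigr => j _; rewrite linearZ.
Qed.

End extension.

(** By [tangent_extends] the test fields attain every tangent vector at each point; the basis it
    asks for comes from the neutral signature. *)
Lemma metric_app_nondeg (R : realType) (n : nat) (M : manifold R (n + n))
    (g : metric M) (X : vfield M) : neutral_signature n g ->
  (forall W, metric_app g X W = 0) -> X = 0.
Proof.
move=> gn X0; suff Xp p : vf_at X p = 0.
  apply/val_inj/funext => p; exact: (congr1 (@tangent_val _ _ _ p) (Xp p)).
have [e eT _] := gn p; apply: (@metric_nondeg _ _ _ g) => w.
have [W <-] := tangent_extends w eT.
exact: (congr1 (fun f : smooth_fun M => f p) (X0 W)).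
Qed.

(** * Connections with skew torsion *)

Lemma scaler_half_double (R : numFieldType) (V : lmodType R) (v : V) :
  2^-1 *: v + 2^-1 *: v = v.
Proof. by rewrite -scalerDr -mulr2n -(scaler_nat _ v) scalerA mulVf ?scale1r ?pnatr_eq0. Qed.

Section additive_maps.
Variables (R : numFieldType) (V W : lmodType R) (f : V -> W).
Hypothesis fD : {morph f : x y / x + y}.

Lemma addf0 : f 0 = 0.
Proof. by apply: (addrI (f 0)); rewrite -fD !addr0. Qed.

Lemma addfN : {morph f : x / - x}.
Proof. by move=> x; apply: (addrI (f x)); rewrite -fD !subrr addf0. Qed.

Lemma addfB : {morph f : x y / x - y}.
Proof. by move=> x y; rewrite fD addfN. Qed.

(** Additivity suffices for this scalar: [f x] is twice [f (2^-1 *: x)]. *)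
Lemma addf_half x : f (2^-1 *: x) = 2^-1 *: f x.
Proof. by rewrite -[x in RHS]scaler_half_double fD scalerDr scaler_half_double. Qed.

End additive_maps.

Lemma lmod_mulrSn_eq0 (R : numFieldType) (V : lmodType R) (v : V) n :
  v *+ n.+1 = 0 -> v = 0.
Proof.
by move=> /eqP; rewrite -scaler_nat scaler_eq0 pnatr_eq0 /= => /eqP.
Qed.

Section vector_field_algebra.
Variables (R : realType) (m : nat) (M : manifold R m).
Implicit Types (X Y Z W : vfield M) (f h : smooth_fun M).

Lemma vf_zeroE (p : M) f : (0 : M -> smooth_fun M -> R) p f = 0.
Proof. by []. Qed.

Lemma vf_actD X : {morph vf_act X : f h / f + h}.
Proof.
move=> f h; apply/val_inj/funext => p.
by have := ((vfieldP X).1 p).1 1 f h; rewrite scale1r mul1r.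
Qed.

Lemma vf_act_bracket X Y f :
  vf_act (lie_bracket X Y) f = vf_act X (vf_act Y f) - vf_act Y (vf_act X f).
Proof. exact: val_inj. Qed.

Lemma vf_eqP X Y : (forall f, vf_act X f = vf_act Y f) -> X = Y.
Proof.
move=> XY; apply/val_inj/funext => p; apply/funext => f.
exact: (congr1 (fun h : smooth_fun M => h p) (XY f)).
Qed.

Lemma vf_act_vfD X Y f : vf_act (X + Y) f = vf_act X f + vf_act Y f.
Proof. exact: val_inj. Qed.

Lemma vf_act_vfN X f : vf_act (- X) f = - vf_act X f.
Proof. exact: val_inj. Qed.

Lemma vf_act_vf0 f : vf_act (0 : vfield M) f = 0.
Proof. exact: val_inj. Qed.

Lemma lie_bracketC X Y : lie_bracket X Y = - lie_bracket Y X.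
Proof.
by apply: vf_eqP => f; rewrite vf_act_vfN !vf_act_bracket opprB.
Qed.

Lemma lie_bracketDl Y : {morph (fun X => lie_bracket X Y) : X X' / X + X'}.
Proof.
move=> X X'; apply: vf_eqP => f.
by rewrite vf_act_vfD !vf_act_bracket !vf_act_vfD vf_actD; ring.
Qed.

Lemma jacobi X Y Z : lie_bracket (lie_bracket X Y) Z +
  lie_bracket (lie_bracket Y Z) X + lie_bracket (lie_bracket Z X) Y = 0.
Proof.
apply: vf_eqP => f; rewrite vf_act_vf0 !vf_act_vfD !vf_act_bracket.
by rewrite !(addfB (vf_actD _)); ring.
Qed.

Lemma vf_fscale1 X : vf_fscale 1 X = X.
Proof. by apply: vf_eqP => f; apply/val_inj/funext => p; exact: mul1r. Qed.

Lemma endo_appD (P : endo_field M) : {morph endo_app P : X Y / X + Y}.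
Proof.
move=> X Y; apply/val_inj/funext => p; rewrite /= fctE /=.
by rewrite -[X in _ = X]/(tangent_val (P p (vf_at X p) + P p (vf_at Y p))) -linearD;
  congr (tangent_val (P p _)); exact: val_inj.
Qed.

Lemma metric_app_sym (g : metric M) X Y : metric_app g X Y = metric_app g Y X.
Proof. by apply/val_inj/funext => p; exact: Defs.metric_sym. Qed.

Lemma metric_appDl (g : metric M) Y : {morph (fun X => metric_app g X Y) : X X' / X + X'}.
Proof.
move=> X X'; apply/val_inj/funext => p /=; rewrite fctE.
have := Defs.metric_lin g (vf_at Y p) 1 (vf_at X p) (vf_at X' p).
by rewrite scale1r mul1r => <-; congr (g p _ _); exact: val_inj.
Qed.

Lemma metric_appDr (g : metric M) X : {morph metric_app g X : Y Y' / Y + Y'}.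
Proof. by move=> Y Y'; rewrite !(metric_app_sym _ X) metric_appDl. Qed.

Lemma connectionDl (D : vfield M -> vfield M -> vfield M) Y : is_connection D ->
  {morph (fun X => D X Y) : X X' / X + X'}.
Proof. by move=> [Dl _ _] X X'; have := Dl 1 X X' Y; rewrite !vf_fscale1. Qed.

End vector_field_algebra.

(** Vector fields form only a module, so a linear identity is checked on its real values at a point
    and a function, where [ring] applies. *)
Ltac vf_abel := apply/val_inj/funext => ?; apply/funext => ?;
  rewrite /= ?fctE /GRing.scale /= ?vf_zeroE; ring.

(** * The Bianchi identity with torsion and the skew-symmetries *)

Section skew_torsion.
Variables (R : realType) (m : nat) (M : manifold R m) (g : metric M).
Variables (D T : vfield M -> vfield M -> vfield M) (P : vfield M -> vfield M).
(* The torsion is kept as a variable: unification would otherwise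
   unfold it to a difference. *)
Hypothesis TE : T = torsion D.
Implicit Types (X Y Z W : vfield M).

Let B := cov_bilin D T.
Let G := metric_app g.
Let GC X Y : G X Y = G Y X := metric_app_sym g X Y.
Let GDl Y : {morph (fun X => G X Y) : X X' / X + X'} := metric_appDl g Y.
Let GDr X : {morph G X : Y Y' / Y + Y'} := metric_appDr g X.

Definition curvature X Y Z : vfield M :=
  D X (D Y Z) - D Y (D X Z) - D (lie_bracket X Y) Z.

Hypothesis DDl : forall Y, {morph (fun X => D X Y) : X X' / X + X'}.
Hypothesis DDr : forall X, {morph D X : Y Y' / Y + Y'}.

Lemma torsionC X Y : T X Y = - T Y X.
Proof. by rewrite TE /torsion (lie_bracketC X); vf_abel. Qed.

Lemma torsionDl Y : {morph (fun X => T X Y) : X X' / X + X'}.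
Proof.
by move=> X X'; rewrite TE /torsion DDl DDr lie_bracketDl; vf_abel.
Qed.

Lemma torsionDr X : {morph T X : Y Y' / Y + Y'}.
Proof. by move=> Y Y'; rewrite !(torsionC X) torsionDl opprD. Qed.

Lemma cov_torsionC X Y Z : B X Y Z = - B X Z Y.
Proof.
rewrite /B /cov_bilin (torsionC (D X Y)) (torsionC Y (D X Z)) (torsionC Y Z).
by rewrite (addfN (DDr X)); vf_abel.
Qed.

Lemma cov_torsionDl Y Z : {morph (fun X => B X Y Z) : X X' / X + X'}.
Proof.
by move=> X X'; rewrite /B /cov_bilin !DDl torsionDl torsionDr; vf_abel.
Qed.

Lemma cov_torsionDm X Z : {morph (fun Y => B X Y Z) : Y Y' / Y + Y'}.
Proof.
by move=> Y Y'; rewrite /B /cov_bilin DDr !torsionDl DDr; vf_abel.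
Qed.

(** Once torsion and curvature are expanded, the two sides differ by the cyclic sum of double
    brackets, which vanishes by [jacobi]. *)
Lemma bianchi_torsion X Y Z :
  curvature X Y Z + curvature Y Z X + curvature Z X Y =
  B X Y Z + B Y Z X + B Z X Y + (T (T X Y) Z + T (T Y Z) X + T (T Z X) Y).
Proof.
have J := jacobi X Y Z.
(* Of the outer torsion only the bracket part is expanded: the terms [T (D U V) W] cancel against
   those of [B]. *)
have TT U V W : T (T U V) W = T (D U V) W - T (D V U) W - D (lie_bracket U V) W
    + D W (lie_bracket U V) + lie_bracket (lie_bracket U V) W.
  have -> : T (T U V) W = T (D U V - D V U - lie_bracket U V) W by rewrite {2}TE.
  rewrite !(addfB (torsionDl W)).
  have -> : T (lie_bracket U V) W =
    D (lie_bracket U V) W - D W (lie_bracket U V) - lie_bracket (lie_bracket U V) W.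
    by rewrite TE.
  by vf_abel.
have DT U V W : D U (T V W) = D U (D V W) - D U (D W V) - D U (lie_bracket V W).
  by rewrite TE /torsion !(addfB (DDr U)).
rewrite -[LHS]addr0 -J !TT /B /cov_bilin !DT /curvature.
rewrite (torsionC Y (D X Z)) (torsionC Z (D Y X)) (torsionC X (D Z Y)).
vf_abel.
Qed.

Lemma metric_bianchi X Y Z W :
  G (curvature X Y Z) W + G (curvature Y Z X) W + G (curvature Z X Y) W =
  G (B X Y Z) W + G (B Y Z X) W + G (B Z X Y) W +
  (G (T (T X Y) Z) W + G (T (T Y Z) X) W + G (T (T Z X) Y) W).
Proof. by rewrite -!GDl bianchi_torsion. Qed.

Hypothesis Dg : forall X Y Z, vf_act X (G Y Z) = G (D X Y) Z + G Y (D X Z).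

(** The bracket acts on the function [G Z W] as a commutator; metric compatibility evaluates both
    sides. *)
Lemma curvature_skew X Y Z W : G (curvature X Y Z) W = - G Z (curvature X Y W).
Proof.
have := vf_act_bracket X Y (G Z W).
rewrite !Dg !vf_actD !Dg /curvature.
rewrite !(addfB (GDl _)) !(addfB (GDr _)) => E.
by apply/eqP; rewrite -subr_eq0 -(subrr (G (D (lie_bracket X Y) Z) W +
  G Z (D (lie_bracket X Y) W))) [X in _ == X - _]E; apply/eqP; ring.
Qed.

Hypothesis Tskew : forall X Y Z, G (T X Y) Z = - G Y (T X Z).

(** This is the derivative of [Tskew] along [X], the metric being parallel. *)
Lemma cov_torsion_skew X Y Z W : G (B X Y Z) W = - G Z (B X Y W).
Proof.
have := Dg X (T Y Z) W.
rewrite Tskew (addfN (vf_actD X)) Dg => E.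
rewrite /B /cov_bilin.
rewrite !(addfB (GDl _)) !(addfB (GDr _)) -/G.
have -> : G (D X (T Y Z)) W = - (G (D X Z) (T Y W) + G Z (D X (T Y W))) - G (T Y Z) (D X W).
  by rewrite E addrK.
by rewrite !Tskew; ring.
Qed.

(** * Eigenbundles of [P] *)

Hypothesis PD : {morph P : X Y / X + Y}.
Hypothesis PK : involutive P.
Hypothesis GP : forall X Y, G (P X) Y = - G X (P Y).
Hypothesis DP : forall X Y, D X (P Y) = P (D X Y).
Hypothesis TP : forall X Y, T (P X) Y = - P (T X Y).

(* [eig s] is the space of sections of the eigenbundle of [P] for the
   eigenvalue -1 if [s], +1 otherwise. *)
Definition eig (s : bool) X := P X = (-1) ^+ s *: X.

Lemma eigE s X : eig s X <-> P X = if s then - X else X.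
Proof. by rewrite /eig; case: s; rewrite ?scaleN1r ?scale1r. Qed.

Lemma eigD s X Y : eig s X -> eig s Y -> eig s (X + Y).
Proof. by rewrite /eig PD scalerDr => -> ->. Qed.

Lemma eigN s X : eig s X -> eig s (- X).
Proof. by rewrite /eig (addfN PD) scalerN => ->. Qed.

Lemma eigB s X Y : eig s X -> eig s Y -> eig s (X - Y).
Proof. by move=> eX eY; exact/eigD/eigN. Qed.

Lemma eig_connection s X Y : eig s Y -> eig s (D X Y).
Proof.
by move=> /eigE eY; apply/eigE; rewrite -DP eY; case: s {eY} => //; exact: addfN.
Qed.

Lemma eig_curvature s X Y Z : eig s Z -> eig s (curvature X Y Z).
Proof.
move=> eZ; rewrite /curvature; apply: eigB; first apply: eigB.
- exact/eig_connection/eig_connection.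
- exact/eig_connection/eig_connection.
- exact: eig_connection.
Qed.

(** [TP] and skew-symmetry give [T X (P Y) = T (P X) Y]; for opposite eigenvalues this says that
    [T X Y] equals its own negative. *)
Lemma torsion_mixed s X Y : eig s X -> eig (~~ s) Y -> T X Y = 0.
Proof.
move=> /eigE eX /eigE eY; apply: (@lmod_mulrSn_eq0 _ _ _ 1).
have TPr : T X (P Y) = T (P X) Y.
  by rewrite torsionC TP [RHS]TP (torsionC X Y) (addfN PD) opprK.
move: TPr; rewrite eX eY mulr2n; case: s {eX eY} => /= E.
  by rewrite {1}E (addfN (torsionDl Y)) addNr.
by rewrite -{1}E (addfN (torsionDr X)) addNr.
Qed.

Lemma eig_torsion s X Y : eig s X -> eig s Y -> eig (~~ s) (T X Y).
Proof.
move=> /eigE eX eY; apply/eigE; rewrite -[LHS]opprK -TP eX.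
by case: s {eX eY} => //=; rewrite (addfN (torsionDl Y)) opprK.
Qed.

Lemma metric_isotropic s X Y : eig s X -> eig s Y -> G X Y = 0.
Proof.
move=> /eigE eX /eigE eY; apply: (@lmod_mulrSn_eq0 _ _ _ 1).
rewrite mulr2n; have := GP X Y; rewrite eX eY; case: s {eX eY}; last first.
  by move=> {1}->; rewrite addNr.
rewrite (addfN (GDl _)) (addfN (GDr _)) opprK => {1}<-.
by rewrite addNr.
Qed.

Lemma cov_torsion_mixed s X Y Z : eig s Y -> eig (~~ s) Z -> B X Y Z = 0.
Proof.
move=> eY eZ; rewrite /B /cov_bilin !(@torsion_mixed s)//; try exact: eig_connection.
by rewrite (addf0 (DDr X)) !subr0.
Qed.

Lemma eig_cov_torsion s X Y Z : eig s Y -> eig s Z -> eig (~~ s) (B X Y Z).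
Proof.
move=> eY eZ; have c := eig_connection.
by rewrite /B /cov_bilin; apply: eigB; [apply: eigB|];
  do ?[exact: eig_torsion | apply: c]; apply: eig_torsion => //; apply: c.
Qed.

Lemma cov_torsion_opposite s X Y Z W :
  eig (~~ s) X -> eig s Y -> eig s Z -> eig s W -> G (B X Y Z) W = 0.
Proof.
move=> eX eY eZ eW.
(* Bianchi for [X], [U], [V] paired with [V']: the other two curvatures, as well as [T (T U V) X],
   have type [s] and pair to zero, and the remaining terms are mixed. *)
have curvE U V V' : eig s U -> eig s V -> eig s V' ->
    G (curvature U V X) V' = G (B X U V) V'.
  move=> eU eV eV'.
  have := metric_bianchi X U V V'.
  rewrite (@metric_isotropic s (curvature X U V))//; last exact: eig_curvature.
  rewrite (@metric_isotropic s (curvature V X U))//; last exact: eig_curvature.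
  rewrite (@cov_torsion_mixed s U V X)// (@cov_torsion_mixed (~~ s) V X U) ?negbK//.
  rewrite (@torsion_mixed (~~ s) X U) ?negbK// (@torsion_mixed s V X)//.
  rewrite !(addf0 (torsionDl _)) !(addf0 (GDl _)).
  rewrite (@metric_isotropic s (T _ X))//; last first.
    by rewrite -[s]negbK; apply: eig_torsion => //; exact: eig_torsion.
  by rewrite !addr0 !add0r.
(* Here the right-hand side vanishes: [B] takes values in the type of [X], and the double torsions
   are mixed. *)
have := metric_bianchi Y Z W X.
rewrite !(@metric_isotropic (~~ s) (B _ _ _) X)//; do ?exact: eig_cov_torsion.
rewrite !(@torsion_mixed (~~ s) (T _ _)) ?negbK//; do ?exact: eig_torsion.
rewrite !(addf0 (GDl _)) !addr0.
(* Moved across [G], each curvature term becomes by [curvE] minus a cyclic rotation of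
   [G (B X Y Z) W]. The rotations agree by skew-symmetry, so the sum is -3 times this function. *)
rewrite !curvature_skew ![G _ (curvature _ _ X)]GC !curvE//.
have -> : G (B X W Y) Z = G (B X Y Z) W.
  by rewrite cov_torsionC (addfN (GDl _)) cov_torsion_skew opprK [LHS]GC.
have -> : G (B X Z W) Y = G (B X Y Z) W.
  rewrite cov_torsion_skew cov_torsionC (addfN (GDr _)) opprK.
  by rewrite [LHS]GC.
move=> E; apply: (@lmod_mulrSn_eq0 _ _ _ 2); apply: oppr_inj.
by rewrite oppr0 -E; ring.
Qed.

Lemma cov_torsion_same s X Y Z W :
  eig s X -> eig s Y -> eig s Z -> eig s W -> G (B X Y Z) W = 0.
Proof.
move=> eX eY eZ eW.
(* The curvatures have the same type as [V''] and pair to zero; the double torsions are mixed. *)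
have cyc U V V' V'' : eig s U -> eig s V -> eig s V' -> eig s V'' ->
    G (B U V V') V'' + G (B V V' U) V'' + G (B V' U V) V'' = 0.
  move=> eU eV eV' eV''.
  have := metric_bianchi U V V' V''.
  rewrite !(@metric_isotropic s (curvature _ _ _) V'')//; do ?exact: eig_curvature.
  rewrite !(@torsion_mixed (~~ s) (T _ _)) ?negbK//; do ?exact: eig_torsion.
  by rewrite !(addf0 (GDl _)) !addr0 => /esym.
have sw U V V' V'' : G (B U V V') V'' = - G (B U V' V) V''.
  by rewrite cov_torsionC (addfN (GDl _)).
have ws U V V' V'' : G (B U V V') V'' = - G (B U V V'') V'.
  by rewrite cov_torsion_skew GC.
(* Each of the four fields is paired in turn. With [a], [b], [c], [d] as below, skew-symmetry turns
   the identities into a+b+c = 0, -b-c+d = 0, a+c-d = 0 and d-a-b = 0. *)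
have E1 := cyc X Y Z W eX eY eZ eW.
have := cyc Y Z W X eY eZ eW eX.
rewrite (ws Y Z W) (sw Z W Y) (ws Z Y W) (sw Z Y X) (ws W Y Z) (sw W Y X) => E2.
have := cyc Z W X Y eZ eW eX eY.
rewrite (sw Z W X) (ws Z X W) (ws W X Z) (ws X Z W) (sw X Z Y) => E3.
have := cyc W X Y Z eW eX eY eZ.
rewrite (ws X Y W) (sw Y W X) (ws Y X W) (sw Y X Z) => E4.
apply: (@lmod_mulrSn_eq0 _ _ _ 2).
pose a := G (B X Y Z) W; pose b := G (B Y Z X) W.
pose c := G (B Z X Y) W; pose d := G (B W X Y) Z.
(* The combination E1 + 2 E2 + E3 - E4 eliminates [b], [c] and [d]. *)
have -> : a *+ 3 = (a + b + c) + (- b + - - - c + - - d) *+ 2 +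
    (- - c + - d + - - a) - (d + - a + - - - b).
  by ring.
by rewrite E1 E2 E3 E4 mul0rn subr0 !addr0.
Qed.

Hypothesis gN : forall X, (forall W, G X W = 0) -> X = 0.

Lemma eig_decomposition X : exists X1 X2, [/\ eig false X1, eig true X2 & X = X1 + X2].
Proof.
exists (2^-1 *: (X + P X)), (2^-1 *: (X - P X)); split.
- by apply/eigE; rewrite (addf_half PD) PD PK addrC.
- by apply/eigE; rewrite (addf_half PD) (addfB PD) PK -scalerN opprB.
- by rewrite !scalerDr addrACA scaler_half_double scalerN subrr addr0.
Qed.

Lemma cov_torsion_eq0 X Y Z : B X Y Z = 0.
Proof.
have homog s s' s'' U V V' : eig s U -> eig s' V -> eig s'' V' -> B U V V' = 0.
  move=> eU eV eV'; have [ss|ss] := boolP (s' == s''); last first.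
    apply: (@cov_torsion_mixed s') => //.
    by case: s' s'' ss eV' {eV} => -[].
  move: ss eV' => /eqP <- eV'.
  have key W : eig s' W -> G (B U V V') W = 0.
    move=> eW; have [ss|ss] := boolP (s == s').
      by move: ss eU => /eqP -> eU; exact: (@cov_torsion_same s').
    apply: (@cov_torsion_opposite s') => //.
    by case: s s' ss eU {eV eV' eW} => -[].
  (* [B U V V'] has type [~~ s'], so by isotropy only the component of [W] of type [s'] contributes,
     and [key] handles it. *)
  apply: gN => W; have [W1 [W2 [e1 e2 ->]]] := eig_decomposition W.
  have e0 := eig_cov_torsion U eV eV'.
  rewrite GDr.
  case: s' eV eV' key e0 => eV eV' key e0.
    by rewrite (key _ e2) (metric_isotropic e0 e1) addr0.
  by rewrite (key _ e1) (metric_isotropic e0 e2) addr0.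
have [X1 [X2 [eX1 eX2 ->]]] := eig_decomposition X.
have [Y1 [Y2 [eY1 eY2 ->]]] := eig_decomposition Y.
have [Z1 [Z2 [eZ1 eZ2 ->]]] := eig_decomposition Z.
have BDr U V : {morph B U V : A A' / A + A'}.
  by move=> A A'; rewrite !(cov_torsionC U V) cov_torsionDm opprD.
by rewrite cov_torsionDl !cov_torsionDm !BDr;
  do !(erewrite homog; [|by eauto..]); rewrite !addr0.
Qed.

End skew_torsion.

(** * The canonical connection *)

Section nearly_paraKahler.
Variables (R : realType) (n : nat) (M : manifold R (n + n)).
Variables (g : metric M) (P : endo_field M).
Variable D : vfield M -> vfield M -> vfield M.
Hypotheses (LC : levi_civita g D) (NPK : nearly_paraKahler n g P D).
Implicit Types (X Y Z : vfield M).

Let p := endo_app P.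
Let G := metric_app g.
Let GDl Y : {morph (fun X => G X Y) : X X' / X + X'} := metric_appDl g Y.
Let GDr X : {morph G X : Y Y' / Y + Y'} := metric_appDr g X.
Let pD : {morph p : X Y / X + Y} := @endo_appD _ _ _ P.

Let DDl Y : {morph (fun X => D X Y) : X X' / X + X'}.
Proof. by have [cD _ _] := LC; exact: connectionDl. Qed.

Let DDr X : {morph D X : Y Y' / Y + Y'}.
Proof. by have [[_ Dr _] _ _] := LC; exact: Dr. Qed.

Let Dg X Y Z : vf_act X (G Y Z) = G (D X Y) Z + G Y (D X Z).
Proof. by have [_ _] := LC; exact. Qed.

Let lieE X Y : lie_bracket X Y = D X Y - D Y X.
Proof.
have [_ /(_ X Y) + _] := LC.
by rewrite /torsion => /eqP; rewrite subr_eq0 => /eqP.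
Qed.

Let pK : involutive p.
Proof.
have [[PK _ _ _ _] _ _] := NPK.
move=> X; apply/val_inj/funext => q /=.
rewrite -[RHS]/(tangent_val (vf_at X q)) -[in RHS](PK q (vf_at X q)).
by congr (tangent_val (P q _)); exact: val_inj.
Qed.

Let Gp X Y : G (p X) Y = - G X (p Y).
Proof.
have [[_ _ _ _ gP] _ _] := NPK.
apply/eqP; rewrite -addr_eq0; apply/eqP/val_inj/funext => q.
rewrite -[RHS](gP q (vf_at X q) (vf_at Y q)) /=.
by congr (g q _ _ + g q _ _); exact: val_inj.
Qed.

Let A := cov_endo D P.
Let T X Y := p (A X Y).

Lemma cov_endoDl Y : {morph (fun X => A X Y) : X X' / X + X'}.
Proof. by move=> U V; rewrite /A /cov_endo !DDl -/p pD; vf_abel. Qed.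

Lemma cov_endoDr X : {morph A X : Y Y' / Y + Y'}.
Proof. by move=> U V; rewrite /A /cov_endo -/p pD !DDr pD; vf_abel. Qed.

(** Polarisation of the nearly paraKähler condition. *)
Lemma cov_endoC X Y : A X Y = - A Y X.
Proof.
have [_ _ A0] := NPK.
have := A0 (X + Y); rewrite -/A cov_endoDl !cov_endoDr {1 4}/A !A0 add0r addr0 => /eqP.
by rewrite addr_eq0 => /eqP.
Qed.

(** The covariant derivative of P^2 = id. *)
Lemma cov_endo_anti X Y : A X (p Y) = - p (A X Y).
Proof. by rewrite /A /cov_endo -/p pK (addfB pD) pK opprB. Qed.

Lemma cov_endo_antil X Y : A (p X) Y = - p (A X Y).
Proof. by rewrite cov_endoC cov_endo_anti opprK cov_endoC (addfN pD). Qed.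

(** [P] is skew for the parallel metric [g], so its covariant derivative is skew too. *)
Lemma cov_endo_skew X Y Z : G (A X Y) Z = - G Y (A X Z).
Proof.
rewrite /A /cov_endo -/p (addfB (GDl _)) (addfB (GDr _)) Gp -(Gp Y).
have := Dg X (p Y) Z; have := Dg X Y (p Z).
by rewrite !Gp (addfN (vf_actD X)) => -> /eqP; rewrite -subr_eq0 => /eqP E;
  rewrite -[RHS]addr0 -oppr0 -E; ring.
Qed.

Let TC X Y : T X Y = - T Y X.
Proof. by rewrite /T cov_endoC (addfN pD). Qed.

Let Tskew X Y Z : G (T X Y) Z = - G Y (T X Z).
Proof.
by rewrite /T Gp cov_endo_skew opprK cov_endo_anti (addfN (GDr _)).
Qed.

Let Tp X Y : T (p X) Y = - p (T X Y).
Proof. by rewrite /T cov_endo_antil (addfN pD). Qed.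

(** In this section [N] is the canonical connection, not the Nijenhuis tensor. *)
Let N := canonical_connection D P.

Lemma canonical_connectionE X Y : N X Y = D X Y + 2^-1 *: T X Y.
Proof.
by rewrite /N /canonical_connection -/A -/p cov_endo_anti scalerN opprK.
Qed.

Lemma torsion_canonical X Y : torsion N X Y = T X Y.
Proof.
rewrite /torsion !canonical_connectionE lieE (TC Y X) scalerN.
by rewrite -[RHS]scaler_half_double; vf_abel.
Qed.

(** With brackets written through the torsion-free [D], all terms in which [P] is not differentiated
    cancel; what remains is four copies of [- p (A X Y)]. *)
Lemma nijenhuis_torsion X Y : nijenhuis P X Y = - torsion N X Y.
Proof.
rewrite torsion_canonical /nijenhuis -/p /T.
have: forall U V, D U (p V) = A U V + p (D U V).
  by move=> U V; rewrite /A /cov_endo subrK.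
have := cov_endoC; have := cov_endo_antil.
(* [A] becomes an abstract map with the three listed properties, which keeps it from unfolding. *)
generalize A => B Bp BC Dp.
rewrite !lieE !Dp !(addfB pD) !pD !pK !Bp (BC Y X) !(addfN pD).
apply/val_inj/funext => q; apply/funext => f.
by rewrite /= ?fctE /GRing.scale /=; field.
Qed.

Lemma canonicalDl Y : {morph (fun X => N X Y) : X X' / X + X'}.
Proof.
move=> X X'; rewrite !canonical_connectionE DDl /T cov_endoDl pD scalerDr.
by rewrite addrACA.
Qed.

Lemma canonicalDr X : {morph N X : Y Y' / Y + Y'}.
Proof.
move=> Y Y'; rewrite !canonical_connectionE DDr /T cov_endoDr pD scalerDr.
by rewrite addrACA.
Qed.

(** The correction [2^-1 *: T] is skew for [g], so its two contributions cancel. *)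
Lemma canonical_metric X Y Z : vf_act X (G Y Z) = G (N X Y) Z + G Y (N X Z).
Proof.
rewrite Dg !canonical_connectionE GDl GDr (addf_half (GDl _)) (addf_half (GDr _)).
by rewrite Tskew scalerN addrACA addNr addr0.
Qed.

(** As [T X (p Y)] is [- A X Y], the correction removes half of the defect [A X Y] on the left and
    adds the other half on the right. *)
Lemma canonical_endo X Y : N X (p Y) = p (N X Y).
Proof.
have Dp : D X (p Y) = A X Y + p (D X Y) by rewrite /A /cov_endo subrK.
rewrite !canonical_connectionE Dp pD (addf_half pD) /T cov_endo_anti (addfN pD) pK.
by rewrite -[X in X + p _]scaler_half_double scalerN; vf_abel.
Qed.

Lemma canonical_torsion_parallel X Y Z : cov_bilin N (torsion N) X Y Z = 0.
Proof.
have [[_ _ _ gn _] _ _] := NPK.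
apply: (@cov_torsion_eq0 _ _ _ g N _ p) => //.
- exact: canonicalDl.
- exact: canonicalDr.
- exact: canonical_metric.
- by move=> U V W; rewrite -!/(G _ _) !torsion_canonical; exact: Tskew.
- exact: canonical_endo.
- by move=> U V; rewrite !torsion_canonical; exact: Tp.
- by move=> U; exact: metric_app_nondeg gn.
Qed.

End nearly_paraKahler.

Theorem theorem5p3 (R : realType) (n : nat) (M : manifold R (n + n))
    (g : metric M) (P : endo_field M) (nablag : vfield M -> vfield M -> vfield M)
    (LC : levi_civita g nablag) (NPK : nearly_paraKahler n g P nablag) :
  let nabla := canonical_connection nablag P in
  let N := nijenhuis P in
  let T := torsion nabla in
  forall X Y Z : vfield M,
    cov_bilin nabla N X Y Z = - cov_bilin nabla T X Y Z /\
    - cov_bilin nabla T X Y Z = 0.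
Proof.
move=> nabla N T X Y Z.
have -> : N = fun U V => - T U V.
  by apply/funext => U; apply/funext => V; exact: nijenhuis_torsion LC NPK U V.
split; last by rewrite (canonical_torsion_parallel LC NPK) oppr0.
by rewrite /cov_bilin /nabla (addfN (canonicalDr LC NPK X)) !opprD.
Qed.
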